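(* Let $X$ be the axis-parallel path of shape $\nu=(\nu_1,\dots,\nu_m)$ and sequence of lengths $a=(a_1,\dots,a_m)$. Then the $(i_1\dots i_k)$-th entry of the $k$-th signature of $X$ is $$\sigma(X)_{i_1\dots i_k}=\sum_{(j_1,\dots,j_k)}\frac{1}{s_1!s_2!\cdots s_m!}\,a_{j_1}a_{j_2}\cdots a_{j_k},$$ where the sum is over all non-decreasing sequences $(j_1,j_2,\dots,j_k)$ of elements of $\{1,\dots,m\}$ such that $j_l\in\pi_{i_l}$ for all $l\in\{1,\dots,k\}$, and $s_l$ counts the number of times that $l$ appears in $(j_1,j_2,\dots,j_k)$.
   Context: For a piecewise smooth path $X:[0,1]\to\mathbb{R}^d$ with coordinates $X_i$, its $k$-th signature is the tensor in $(\mathbb{R}^d)^{\otimes k}$ with $(i_1\dots i_k)$-th entry $\sigma(X)_{i_1\dots i_k}=\int_0^1\int_0^{t_k}\cdots\int_0^{t_2}\dot X_{i_1}(t_1)\cdots\dot X_{i_k}(t_k)\,dt_1\cdots dt_k$. The axis-parallel path of shape $\nu=(\nu_1,\dots,\nu_m)$, with $\{\nu_1,\dots,\nu_m\}=\{1,\dots,d\}$, and sequence of lengths $a=(a_1,\dots,a_m)\in\mathbb{R}^m$ is the piecewise linear path obtained by concatenating, in this order, the linear steps $a_1e_{\nu_1},\dots,a_me_{\nu_m}$, where $e_1,\dots,e_d$ is the standard basis of $\mathbb{R}^d$. The shape induces the partition $\{\pi_1|\dots|\pi_d\}$ of $\{1,\dots,m\}$ with $\pi_i=\{j\in\{1,\dots,m\}\mid\nu_j=i\}$.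 *)

(* Defs.v *)
From Stdlib Require Import Reals.
From Coquelicot Require Import Coquelicot.
From HB Require Import structures.
From mathcomp Require Import all_boot all_order all_algebra.
From mathcomp Require Import Rstruct.

Set Implicit Arguments.
Unset Strict Implicit.
Unset Printing Implicit Defensive.

Import Order.TTheory GRing.Theory Num.Theory.
Local Open Scope ring_scope.

(* A path [0,1] -> R^d is given by a function on all of R, of which only the
   values on [0,1] matter.  [Derive] is total: where a coordinate is not
   differentiable its value is arbitrary, which for a piecewise smooth path
   happens at finitely many times only and does not affect the integrals. *)

(* int_0^T int_0^{t_k} ... int_0^{t_2} f(t_1,...,t_k) dt_1 ... dt_k :
   the outermost variable t_k is the last entry of the tuple. *)
Fixpoint simplex_int (k : nat) : (k.-tuple R -> R) -> R -> R :=
  match k with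
  | 0 => fun f _ => f [tuple]
  | k'.+1 => fun f T =>
      RInt (fun t : R =>
        simplex_int (fun ts : k'.-tuple R => f [tuple of rcons ts t]) t) 0 T
  end.

Definition signature (d k : nat) (X : R -> 'rV[R]_d) (i : k.-tuple 'I_d) : R :=
  simplex_int (fun t : k.-tuple R =>
    \prod_(l < k) Derive (fun s : R => X s ord0 (tnth i l)) (tnth t l)) 1.

(* The step [a_j e_(nu_j)] is run through at constant speed during
   [tau_j, tau_(j+1)] (indices from 0).  The breakpoints
   0 = tau_0 < ... < tau_m = 1 and the starting point are arbitrary. *)
Definition axis_parallel_path (d m : nat) (nu : m.-tuple 'I_d)
    (a : m.-tuple R) (X : R -> 'rV[R]_d) : Prop :=
  exists tau : nat -> R,
    [/\ tau 0%N = 0, tau m = 1,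
        forall j : 'I_m, tau j < tau j.+1
      & forall (j : 'I_m) (t : R), tau j <= t <= tau j.+1 ->
          X t = X (tau j) + ((t - tau j) / (tau j.+1 - tau j)) *:
                            (tnth a j *: delta_mx ord0 (tnth nu j))].

Definition shape_block (d m : nat) (nu : m.-tuple 'I_d) (i : 'I_d) : {set 'I_m} :=
  [set j | tnth nu j == i].

(* Main.v *)
Require Import Defs.
From Stdlib Require Import Reals.
From Coquelicot Require Import Coquelicot.
From HB Require Import structures.
From mathcomp Require Import all_boot all_order all_algebra.
From mathcomp Require Import Rstruct ring.

Set Implicit Arguments.
Unset Strict Implicit.
Unset Printing Implicit Defensive.

Import Order.TTheory GRing.Theory Num.Theory.
Local Open Scope ring_scope.

(** Let [b_l(T)] be the length of the [l]-th step that has been travelled at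
    time [T], and let [G_w(b)] be the claimed sum for the word [w], with the
    lengths [b] in place of [a].  Grouping equal indices turns each term of
    [G_w(b)] into a product of divided powers [b_l ^ s_l / s_l!].  The iterated
    integral up to time [T] equals [G_w(b(T))] for every [T], and [T = 1] is
    the theorem.

    The reason is one differential equation.  While the step [n] is being run
    through, the lengths before [n] are full, those after [n] are zero and only
    [b_n] moves.  A non-decreasing sequence with an entry beyond [n]
    contributes zero, and one that stays below [n] contributes a constant; in
    the remaining ones the last entry is [n], and d/db_n lowers the divided
    power of [b_n], which amounts to erasing that last entry.  Hence
    d/db_n G_{w y} = [nu_n = y] G_w ([is_derive_step_signature]).  As
    [nu_n = y] db_n/dt is the velocity of the path in direction [y], the
    fundamental theorem of calculus on each step
    ([is_RInt_step_signature_piece]), the additivity of the integral over the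
    steps ([is_RInt_pieces]) and G_{w y}(0) = 0 show that G_{w y}(b(T)) is the
    integral of the velocity times G_w(b(t)), which is the recursion defining
    iterated integrals ([simplex_int_step_signature]). *)

(** * Appending a letter to a word *)

(** Both the words and the index sequences are taken apart at their last entry,
    because the last letter belongs to the outermost integral. *)
Lemma rcons_tuple_bij (T : finType) (k : nat) :
  bijective (fun p : k.-tuple T * T => rcons_tuple p.1 p.2).
Proof.
apply: inj_card_bij; last by rewrite card_prod !card_tuple expnSr.
move=> [s x] [t y] /= /(congr1 val) /= /rcons_inj [/val_inj -> ->] //.
Qed.

Lemma tnth_rcons_widen (T : Type) (k : nat) (s : k.-tuple T) (x : T) (l : 'I_k) :
  tnth (rcons_tuple s x) (widen_ord (leqnSn k) l) = tnth s l.
Proof. by rewrite !(tnth_nth x) /= nth_rcons size_tuple ltn_ord. Qed.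

Lemma tnth_rcons_max (T : Type) (k : nat) (s : k.-tuple T) (x : T) :
  tnth (rcons_tuple s x) ord_max = x.
Proof. by rewrite (tnth_nth x) /= nth_rcons size_tuple ltnn eqxx. Qed.

(** * Derivatives of sums, affine maps and divided powers *)

Lemma is_derive_bigsum (I : Type) (r : seq I) (P : pred I) (F : I -> R -> R)
    (dF : I -> R) (u : R) :
  (forall i, P i -> is_derive (F i) u (dF i)) ->
  is_derive (fun v => \sum_(i <- r | P i) F i v) u (\sum_(i <- r | P i) dF i).
Proof.
move=> HF; elim: r => [|x r IH].
  rewrite big_nil; apply: (@is_derive_ext R_AbsRing R_NormedModule (fun=> 0)) => [v|]; first by rewrite big_nil.
  exact: is_derive_const.
rewrite big_cons; case Px: (P x).
  apply: (@is_derive_ext R_AbsRing R_NormedModule (fun v => F x v + \sum_(i <- r | P i) F i v)) => [v|].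
    by rewrite big_cons Px.
  by apply: is_derive_plus => //; apply: HF.
by apply: (@is_derive_ext R_AbsRing R_NormedModule) IH => v; rewrite big_cons Px.
Qed.

Lemma is_derive_affine (c p e t : R) :
  is_derive (fun s : R => c * (s - p) + e) t c.
Proof.
apply: (@is_derive_ext R_AbsRing R_NormedModule
  (fun s => Rplus (Rmult c (Rminus s p)) e)) => //.
by auto_derive => //; apply: Rmult_1_r.
Qed.

Lemma is_derive_divided_power (n : nat) (u : R) :
  is_derive (fun v : R => v ^+ n.+1 / n.+1`!%:R) u (u ^+ n / n`!%:R).
Proof.
apply: (@is_derive_ext R_AbsRing R_NormedModule (fun v => n.+1`!%:R^-1 * pow v n.+1)) => [v|].
  by rewrite RpowE mulrC.
have -> : u ^+ n / n`!%:R = (n.+1`!%:R^-1 * (INR n.+1 * 1 * pow u n)).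
  rewrite RpowE INRE factS natrM; field.
  by rewrite nat1r !pnatr_eq0 -lt0n fact_gt0.
by apply: is_derive_scal; apply: is_derive_pow; apply: is_derive_id.
Qed.

(** * Divided monomials *)

Definition divided_monomial (m : nat) (b : 'I_m -> R) (s : seq 'I_m) : R :=
  \prod_(l < m) (b l ^+ count_mem l s / (count_mem l s)`!%:R).

(** The lengths run through so far, in the middle of step [n], where [u] is the
    part of that step already done. *)
Definition run_lengths (m : nat) (a : 'I_m -> R) (n : 'I_m) (u : R) : 'I_m -> R :=
  fun l => if (l < n)%N then a l else if l == n then u else 0.

Lemma divided_monomialE (m : nat) (b : 'I_m -> R) (s : seq 'I_m) :
  divided_monomial b s =
  (\prod_(l < m) (count_mem l s)`!%:R)^-1 * \prod_(x <- s) b x.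
Proof.
rewrite /divided_monomial big_split /= -prodfV mulrC; congr (_ * _).
elim: s => [|x s IH]; first by rewrite big_nil; apply: big1.
rewrite big_cons -IH (bigD1 x) //= [in RHS](bigD1 x) //= eqxx exprS -mulrA.
congr (_ * (_ * _)); apply: eq_bigr => l lx.
by rewrite eq_sym (negPf lx).
Qed.

Lemma count_mem_rcons (T : eqType) (s : seq T) (x l : T) :
  count_mem l (rcons s x) = (count_mem l s + (x == l))%N.
Proof. by rewrite -cats1 count_cat /= addn0. Qed.

Lemma divided_monomial_eq0 (m : nat) (b : 'I_m -> R) (s : seq 'I_m) (x : 'I_m) :
  x \in s -> b x = 0 -> divided_monomial b s = 0.
Proof.
move=> xs bx; rewrite /divided_monomial (bigD1 x) //= bx expr0n.
by rewrite eqn0Ngt -has_count has_pred1 xs /= mul0r mul0r.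
Qed.

(** [x] is the largest entry of [rcons s x].  If [x < n] the variable length does
    not occur, if [x > n] the factor of [x] vanishes identically, and if [x = n]
    the exponent of the variable is one more than its multiplicity in [s], so
    that differentiating the divided power drops the entry [x]. *)
Lemma is_derive_divided_monomial (m : nat) (a : 'I_m -> R) (n x : 'I_m)
    (s : seq 'I_m) (u : R) :
  all (fun p : 'I_m => (p <= x)%N) s ->
  is_derive (fun v => divided_monomial (run_lengths a n v) (rcons s x)) u
    ((x == n)%:R * divided_monomial (run_lengths a n u) s).
Proof.
move=> /allP sx; case: (ltngtP x n) => xn.
- rewrite -val_eqE /= ltn_eqF // mul0r.
  apply: (@is_derive_ext R_AbsRing R_NormedModule (fun=> divided_monomial (run_lengths a n u) (rcons s x)));
    last exact: is_derive_const.
  move=> v; apply: eq_bigr => l _; rewrite /run_lengths.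
  case: (eqVneq l n) => // ->.
  suff /count_memPn -> : n \notin rcons s x by rewrite !expr0.
  rewrite mem_rcons inE -val_eqE /= gtn_eqF //=.
  by apply/negP => /sx; rewrite leqNgt xn.
- rewrite -val_eqE /= gtn_eqF // mul0r.
  apply: (@is_derive_ext R_AbsRing R_NormedModule (fun=> 0)); last exact: is_derive_const.
  move=> v; rewrite (@divided_monomial_eq0 _ _ _ x) //.
    by rewrite mem_rcons mem_head.
  by rewrite /run_lengths ltnNge ltnW //= -val_eqE /= gtn_eqF.
- move/val_inj: xn => ->; rewrite eqxx mul1r.
  pose C := \prod_(l < m | l != n) (run_lengths a n u l ^+ count_mem l s /
                                    (count_mem l s)`!%:R).
  have run_n v : run_lengths a n v n = v by rewrite /run_lengths ltnn eqxx.
  apply: (@is_derive_ext R_AbsRing R_NormedModule (fun v => C * (v ^+ (count_mem n s).+1 /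
                                       (count_mem n s).+1`!%:R))) => [v|].
    rewrite /divided_monomial (bigD1 n) //= run_n count_mem_rcons eqxx addn1 mulrC.
    congr (_ * _); apply: eq_bigr => l ln.
    by rewrite count_mem_rcons eq_sym (negPf ln) addn0 /run_lengths (negPf ln).
  rewrite /divided_monomial (bigD1 n) //= run_n mulrC -/C.
  by apply: is_derive_scal; apply: is_derive_divided_power.
Qed.

(** * The sum over non-decreasing sequences and its derivative *)

Definition admissible (d m k : nat) (nu : m.-tuple 'I_d) (w : k.-tuple 'I_d)
    (j : k.-tuple 'I_m) : bool :=
  sorted (fun p q : 'I_m => (p <= q)%N) j &&
  [forall l : 'I_k, tnth j l \in shape_block nu (tnth w l)].

Definition step_signature (d m k : nat) (nu : m.-tuple 'I_d) (b : 'I_m -> R)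
    (w : k.-tuple 'I_d) : R :=
  \sum_(j : k.-tuple 'I_m | admissible nu w j) divided_monomial b j.

Lemma eq_step_signature (d m k : nat) (nu : m.-tuple 'I_d) (b b' : 'I_m -> R)
    (w : k.-tuple 'I_d) :
  b =1 b' -> step_signature nu b w = step_signature nu b' w.
Proof. by move=> bb; apply: eq_bigr => j _; apply: eq_bigr => l _; rewrite bb. Qed.

Lemma admissible_rcons (d m k : nat) (nu : m.-tuple 'I_d) (w : k.-tuple 'I_d)
    (y : 'I_d) (j : k.-tuple 'I_m) (x : 'I_m) :
  admissible nu (rcons_tuple w y) (rcons_tuple j x) =
  admissible nu w j &&
  (all (fun p : 'I_m => (p <= x)%N) j && (tnth nu x == y)).
Proof.
have leT : transitive (fun p q : 'I_m => (p <= q)%N) by move=> ? ? ?; apply: leq_trans.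
have forallE n (P : pred 'I_n) : [forall l, P l] = \big[andb/true]_(l < n) P l.
  by rewrite big_andE.
rewrite /admissible !sorted_pairwise // pairwise_rcons !forallE big_ord_recr /=.
rewrite !tnth_rcons_max inE.
under eq_bigr do rewrite !tnth_rcons_widen.
by rewrite -!andbA; do !bool_congr.
Qed.

Lemma step_signature_rcons (d m k : nat) (nu : m.-tuple 'I_d) (b : 'I_m -> R)
    (w : k.-tuple 'I_d) (y : 'I_d) :
  step_signature nu b (rcons_tuple w y) =
  \sum_(j : k.-tuple 'I_m | admissible nu w j)
    \sum_(x : 'I_m | all (fun p : 'I_m => (p <= x)%N) j && (tnth nu x == y))
      divided_monomial b (rcons j x).
Proof.
rewrite pair_big_dep /step_signature /= (reindex _ (onW_bij _ (rcons_tuple_bij _ _))) /=.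
by apply: eq_bigl => p; rewrite admissible_rcons.
Qed.

(** Only the sequences ending in [n] have a nonzero derivative.  Erasing this [n]
    leaves a sequence bounded by [n], but the sequences with a larger entry may
    be added back, since their monomials vanish. *)
Lemma is_derive_step_signature (d m k : nat) (nu : m.-tuple 'I_d) (a : 'I_m -> R)
    (n : 'I_m) (w : k.-tuple 'I_d) (y : 'I_d) (u : R) :
  is_derive (fun v => step_signature nu (run_lengths a n v) (rcons_tuple w y)) u
    ((tnth nu n == y)%:R * step_signature nu (run_lengths a n u) w).
Proof.
apply: (@is_derive_ext R_AbsRing R_NormedModule); first by move=> v; rewrite step_signature_rcons.
rewrite [X in is_derive _ _ X]mulr_sumr.
apply: is_derive_bigsum => j _.
have -> : (tnth nu n == y)%:R * divided_monomial (run_lengths a n u) j =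
  \sum_(x : 'I_m | all (fun p : 'I_m => (p <= x)%N) j && (tnth nu x == y))
    (x == n)%:R * divided_monomial (run_lengths a n u) j.
  (* Only the term [x = n] can be nonzero; if it is missing because some entry of
     [j] exceeds [n], the monomial on the left is zero. *)
  case: (boolP (all (fun p : 'I_m => (p <= n)%N) j)) => [jn|/allPn [p pj pn]].
    rewrite -mulr_suml /=; congr (_ * _).
    case: eqP => [<-|ny].
      by rewrite (bigD1 n) ?jn ?eqxx //= big1 ?addr0 // => x /andP [_ /negPf ->].
    by rewrite big1 // => x /andP [_ /eqP xy]; case: eqP => // xn; case: ny; rewrite -xn.
  have D0 : divided_monomial (run_lengths a n u) j = 0.
    apply: (divided_monomial_eq0 pj); rewrite /run_lengths ltnNge ltnW ?ltnNge //=.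
    by case: eqP => // pE; rewrite pE leqnn in pn.
  by rewrite D0 mulr0 big1 // => x _; rewrite mulr0.
apply: is_derive_bigsum => x /andP [jx _].
exact: is_derive_divided_monomial.
Qed.

Lemma step_signature_nil (d m : nat) (nu : m.-tuple 'I_d) (b : 'I_m -> R)
    (w : 0.-tuple 'I_d) : step_signature nu b w = 1.
Proof.
rewrite /step_signature (big_pred1 [tuple]) => [|j]; last first.
  rewrite [j]tuple0 [RHS]eqxx /admissible /=; apply/forallP; case=> //.
by rewrite /divided_monomial big1 // => l _; rewrite /= fact0 expr0 divr1.
Qed.

Lemma step_signature0 (d m k : nat) (nu : m.-tuple 'I_d) (b : 'I_m -> R)
    (w : k.+1.-tuple 'I_d) : (forall l, b l = 0) -> step_signature nu b w = 0.
Proof.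
move=> b0; apply: big1 => j _.
by case/tupleP: j => x j; apply: (@divided_monomial_eq0 _ _ _ x); rewrite ?mem_head.
Qed.

(** * Iterated integrals of products *)

Lemma simplex_int_ext (k : nat) (f g : k.-tuple R -> R) (T : R) :
  f =1 g -> simplex_int f T = simplex_int g T.
Proof.
elim: k f g T => [|k IH] f g T fg; first exact: fg.
by apply: RInt_ext => t _; apply: IH => ts; apply: fg.
Qed.

(** The constant [c] absorbs the factor of the outermost variable.  Pulling that
    factor out of the inner integrals instead would need their integrability,
    which is only known once their value is. *)
Lemma simplex_int_prod_rcons (A : Type) (D : A -> R -> R) (k : nat)
    (w : k.-tuple A) (y : A) (c T : R) :
  simplex_int (fun t => c * \prod_(l < k.+1)
      D (tnth (rcons_tuple w y) l) (tnth t l)) T =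
  RInt (fun s => simplex_int (fun t => (c * D y s) * \prod_(l < k)
      D (tnth w l) (tnth t l)) s) 0 T.
Proof.
apply: RInt_ext => s _; apply: simplex_int_ext => t.
rewrite big_ord_recr /= !tnth_rcons_max [_ * D y s]mulrC mulrA; congr (_ * _).
by apply: eq_bigr => l _; rewrite !tnth_rcons_widen.
Qed.

(** * Piecewise fundamental theorem of calculus *)

Lemma breakpoints_le (tau : nat -> R) (m : nat) :
  (forall n, (n < m)%N -> tau n <= tau n.+1) ->
  forall p q, (p <= q <= m)%N -> tau p <= tau q.
Proof.
move=> Htau p; elim=> [|q IH] /andP [].
  by rewrite leqn0 => /eqP ->.
rewrite leq_eqVlt => /predU1P [-> //|pq qm].
by apply: le_trans (IH _) (Htau q qm); rewrite -ltnS pq ltnW.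
Qed.

Lemma is_RInt_pieces (F f : R -> R) (tau : nat -> R) (m : nat) :
  (forall n, (n < m)%N -> tau n <= tau n.+1) ->
  (forall n (T : R), (n < m)%N -> tau n <= T <= tau n.+1 ->
     is_RInt f (tau n) T (F T - F (tau n))) ->
  forall T : R, tau 0%N <= T <= tau m -> is_RInt f (tau 0%N) T (F T - F (tau 0%N)).
Proof.
elim: m => [|m IH] Htau Hf T /andP [T0 Tm].
  have -> : T = tau 0%N by apply/le_anti; rewrite Tm.
  rewrite subrr; exact: is_RInt_point.
have {}IH := IH (fun n nm => Htau n (ltnW nm)) (fun n T nm => Hf n T (ltnW nm)).
case: (leP T (tau m)) => Ttau; first by apply: IH; rewrite T0.
have -> : F T - F (tau 0%N) = plus (F (tau m) - F (tau 0%N)) (F T - F (tau m)).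
  by rewrite /plus /= RplusE; ring.
apply: is_RInt_Chasles (IH _ _) (Hf _ _ _ _) => //.
  by rewrite lexx (breakpoints_le Htau) //= leqnSn.
by rewrite (ltW Ttau).
Qed.

(** * One step of an axis-parallel path *)

Definition travelled (m : nat) (a : 'I_m -> R) (tau : nat -> R) (T : R) :
    'I_m -> R :=
  fun l => if T <= tau l then 0 else if tau l.+1 <= T then a l
           else a l * ((T - tau l) / (tau l.+1 - tau l)).

(** The right-hand side is affine in [T] on the whole line, so it can be
    differentiated at the ends of the step as well, unlike [travelled]. *)
Lemma travelled_run (m : nat) (a : 'I_m -> R) (tau : nat -> R) (n : 'I_m) (T : R) :
  (forall j : 'I_m, tau j < tau j.+1) -> tau n <= T <= tau n.+1 ->
  travelled a tau T =1
  run_lengths a n (a n * ((T - tau n) / (tau n.+1 - tau n)))%R.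
Proof.
move=> Htau /andP [nT Tn] l; rewrite /travelled /run_lengths.
have tau_le : forall p q, (p <= q <= m)%N -> tau p <= tau q.
  by apply: breakpoints_le => j jm; apply/ltW/(Htau (Ordinal jm)).
case: (ltngtP l n) => ln.
- have lT : tau l.+1 <= T by apply: le_trans nT; apply: tau_le; rewrite ln ltnW.
  by rewrite lT leNgt (lt_le_trans (Htau l) lT).
- rewrite -val_eqE /= gtn_eqF // (le_trans Tn) //.
  by apply: tau_le; rewrite ln ltnW.
- move/val_inj: ln => ->; rewrite eqxx.
  have dn : tau n.+1 - tau n != 0 by rewrite gt_eqF // subr_gt0.
  case: leP => [Tn'|_].
    have -> : T = tau n by apply/le_anti; rewrite Tn'.
    by rewrite subrr mul0r mulr0.
  case: leP => // Tn'.
  have -> : T = tau n.+1 by apply/le_anti; rewrite Tn.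
  by rewrite divff // mulr1.
Qed.

Lemma Derive_linear_step (d : nat) (X : R -> 'rV[R]_d) (p q c : R) (v y : 'I_d)
    (t : R) :
  (forall s, p <= s <= q ->
     X s = X p + ((s - p) / (q - p)) *: (c *: delta_mx ord0 v)) ->
  p < t < q -> Derive (fun s => X s ord0 y) t = (v == y)%:R * (c / (q - p)).
Proof.
move=> HX /andP [pt tq].
rewrite (@Derive_ext_loc _
  (fun s => (v == y)%:R * (c / (q - p)) * (s - p) + X p ord0 y)).
  exact/is_derive_unique/is_derive_affine.
apply: (@locally_interval _ t (Rbar.Finite p) (Rbar.Finite q)); try exact/RltP.
move=> s /= /RltP ps /RltP sq; rewrite HX; last by rewrite !ltW.
rewrite !mxE eqxx /= [y == v]eq_sym; ring.
Qed.

(** On the closed step the integrand is replaced by the derivative of an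
    antiderivative that is smooth on the whole line; the two can differ
    at the breakpoints only, where the velocity is unspecified. *)
Lemma is_RInt_step_signature_piece (d m k : nat) (nu : m.-tuple 'I_d)
    (a : 'I_m -> R) (tau : nat -> R) (D : R -> R) (n : 'I_m)
    (w : k.-tuple 'I_d) (y : 'I_d) (T : R) :
  (forall j : 'I_m, tau j < tau j.+1) -> tau n <= T <= tau n.+1 ->
  (forall t, tau n < t < tau n.+1 ->
     D t = (tnth nu n == y)%:R * (a n / (tau n.+1 - tau n))) ->
  is_RInt (fun t => D t * step_signature nu (travelled a tau t) w) (tau n) T
    (step_signature nu (travelled a tau T) (rcons_tuple w y) -
     step_signature nu (travelled a tau (tau n)) (rcons_tuple w y)).
Proof.
move=> Htau nTn HD; have /andP [nT Tn] := nTn.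
pose u (t : R) : R := a n * ((t - tau n) / (tau n.+1 - tau n)).
pose S k (w : k.-tuple 'I_d) t := step_signature nu (run_lengths a n (u t)) w.
have travS k' (w' : k'.-tuple 'I_d) t : tau n <= t <= tau n.+1 ->
    step_signature nu (travelled a tau t) w' = S k' w' t.
  by move=> nt; apply: eq_step_signature; apply: travelled_run.
have dS k' (w' : k'.-tuple 'I_d) z t : is_derive (S _ (rcons_tuple w' z)) t
    ((tnth nu n == z)%:R * (a n / (tau n.+1 - tau n)) * S k' w' t).
  have du : is_derive u t (a n / (tau n.+1 - tau n)).
    apply: (@is_derive_ext R_AbsRing R_NormedModule
      (fun s => a n / (tau n.+1 - tau n) * (s - tau n) + 0)) => [s|].
      by rewrite /u; ring.
    exact: is_derive_affine.
  have := is_derive_comp _ _ _ _ _ (is_derive_step_signature nu a n w' z (u t)) du.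
  rewrite /scal /= /mult /= RmultE mulrCA mulrA.
  exact.
(* [S] is continuous because it is differentiable: constant for the empty
   word, and by [dS] for a word with a last letter. *)
have cS k' (w' : k'.-tuple 'I_d) t : continuous (S k' w') t.
  apply: ex_derive_continuous; case: k' w' => [|k'] w'.
    exists 0; apply: (@is_derive_ext R_AbsRing R_NormedModule (fun=> 1)) => [s|].
      by rewrite /S step_signature_nil.
    exact: is_derive_const.
  have [g _ gK] := rcons_tuple_bij 'I_d k'.
  by rewrite -(gK w'); eexists; apply: dS.
have minT : Rmin (tau n) T = tau n by apply: Rmin_left; apply/RleP.
have maxT : Rmax (tau n) T = T by apply: Rmax_right; apply/RleP.
rewrite !travS ?nTn ?lexx ?ltW //.
apply: is_RInt_ext; last first.
  apply: is_RInt_derive => t _; first exact: dS.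
  by apply: (@continuous_scal_r _ R_AbsRing R_NormedModule); apply: cS.
rewrite minT maxT => t [/RltP nt /RltP tT].
have tn := lt_le_trans tT Tn.
by rewrite HD ?nt // travS ?ltW.
Qed.

(** * The signature of an axis-parallel path *)

(** The bound [T <= tau m] is part of the induction, because the inner integral
    runs up to the outermost variable. *)
Lemma simplex_int_step_signature (d m : nat) (nu : m.-tuple 'I_d) (a : m.-tuple R)
    (X : R -> 'rV[R]_d) (tau : nat -> R) :
  tau 0%N = 0 -> (forall j : 'I_m, tau j < tau j.+1) ->
  (forall (j : 'I_m) (t : R), tau j <= t <= tau j.+1 ->
     X t = X (tau j) + ((t - tau j) / (tau j.+1 - tau j)) *:
                       (tnth a j *: delta_mx ord0 (tnth nu j))) ->
  forall (k : nat) (w : k.-tuple 'I_d) (c T : R), 0 <= T <= tau m ->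
  simplex_int (fun t => c * \prod_(l < k)
     Derive (fun s => X s ord0 (tnth w l)) (tnth t l)) T =
  c * step_signature nu (travelled (tnth a) tau T) w.
Proof.
move=> tau0 Htau HX; elim=> [|k IH] w c T /andP [T0 Tm].
  by rewrite /= big_ord0 step_signature_nil.
have [g _ gK] := rcons_tuple_bij 'I_d k.
rewrite -(gK w); case: (g w) => {}w y /=.
pose D (z : 'I_d) (t : R) := Derive (fun s => X s ord0 z) t.
apply: etrans (simplex_int_prod_rcons D w y c T) _; rewrite /D.
apply: is_RInt_unique.
apply: (is_RInt_ext (fun t => scal c (Derive (fun s => X s ord0 y) t *
    step_signature nu (travelled (tnth a) tau t) w))).
  rewrite Rmin_left ?Rmax_right; try exact/RleP.
  move=> t [/RltP t0 /RltP tT].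
  rewrite IH -?mulrA //; apply/andP; split; first exact: ltW.
  exact/ltW/(lt_le_trans tT).
apply: is_RInt_scal.
have F0 : step_signature nu (travelled (tnth a) tau 0) (rcons_tuple w y) = 0.
  apply: step_signature0 => l; rewrite /travelled.
  suff -> : 0 <= tau l by [].
  rewrite -tau0; apply: (@breakpoints_le _ m); last exact/ltnW/ltn_ord.
  by move=> n nm; apply/ltW/(Htau (Ordinal nm)).
have : is_RInt (fun t => Derive (fun s => X s ord0 y) t *
    step_signature nu (travelled (tnth a) tau t) w) (tau 0%N) T
   (step_signature nu (travelled (tnth a) tau T) (rcons_tuple w y) -
    step_signature nu (travelled (tnth a) tau (tau 0%N)) (rcons_tuple w y)).
  apply: (@is_RInt_pieces (fun t => step_signature nu (travelled (tnth a) tau t)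
            (rcons_tuple w y)) _ _ m); last by rewrite tau0 T0.
    by move=> n nm; apply/ltW/(Htau (Ordinal nm)).
  move=> n t nm nt.
  apply: (@is_RInt_step_signature_piece _ _ _ _ _ _ _ (Ordinal nm)) => // s sn.
  exact: (Derive_linear_step _ (HX (Ordinal nm)) sn).
by rewrite tau0 F0 subr0.
Qed.

Theorem lemma3p3 (d m : nat) (nu : m.-tuple 'I_d) (a : m.-tuple R)
    (hnu : forall i : 'I_d, i \in nu)
    (X : R -> 'rV[R]_d) (hX : axis_parallel_path nu a X)
    (k : nat) (i : k.-tuple 'I_d) :
  signature X i =
    \sum_(j : k.-tuple 'I_m |
            sorted (fun p q : 'I_m => (p <= q)%N) j &&
            [forall l : 'I_k, tnth j l \in shape_block nu (tnth i l)])
      (\prod_(l < m) ((count_mem l j)`!)%:R)^-1 * \prod_(l < k) tnth a (tnth j l).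
Proof.
have [tau [tau0 taum Htau HX]] := hX.
have := simplex_int_step_signature tau0 Htau HX i 1 (T := 1).
rewrite taum ler01 lexx mul1r => /(_ isT) main.
rewrite /signature -[RHS]/(\sum_(j | admissible nu i j) _).
transitivity (step_signature nu (travelled (tnth a) tau 1) i).
  by rewrite -main; apply: simplex_int_ext => t; rewrite mul1r.
have full l : travelled (tnth a) tau 1 l = tnth a l.
  have l1 : tau l.+1 <= 1.
    rewrite -taum; apply: (@breakpoints_le _ m); last by rewrite ltn_ord leqnn.
    by move=> n nm; apply/ltW/(Htau (Ordinal nm)).
  by rewrite /travelled l1 leNgt (lt_le_trans (Htau l) l1).
rewrite (eq_step_signature _ _ full); apply: eq_bigr => j _.
by rewrite divided_monomialE big_tuple.
Qed.
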